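(* Suppose $k\ge3$ and $\delta\in(0,1)$. Consider any payment scheme in the partial information model in the linear contextual bandit setting, where the myopic agent uses the ordinary least squares estimator. For any $\eta\in(0,1)$, there is an instance for which with probability $1-\delta$, in every round, either the round is unfair, or the expected cost for the principal is at least $\frac{k-1}{k}\cdot(1-\eta)$.
   Context: Linear contextual bandit setting. There are $k$ arms, $T$ rounds, and a dimension $d$; contexts lie in $\mathcal X=\{x\in[0,1]^d:\|x\|\le1\}$. Each arm $j$ has an unknown coefficient vector $\theta_j\in[0,1]^d$ with $\|\theta_j\|\le1$. In each round $t$ an adversary reveals to the agent a context $x^t_j\in\mathcal X$ for each arm $j$. Selecting arm $j$ in round $t$ yields a random reward in $[0,1]$ with distribution $\mathcal F_j^{x_j^t}$ and mean $f_j(x_j^t)=\langle\theta_j,x_j^t\rangle$. An instance consists of the coefficient vectors, the reward distributions, and the adversarially chosen contexts. In each round $t$ the principal draws a payment vector $p^t\in\mathbb R_+^k$ from a distribution that may depend on the principal's information; $p^t_i$ is paid to the agent if it selects arm $i$. The agent forms $\hat\theta^t_i$, the ordinary least squares estimate of $\theta_i$ from its previously observed context/reward pairs for arm $i$ (it is assumed that the agent has enough prior observations that these are well defined), sets $\hat\mu^t_i=\langle\hat\theta_i^t,x_i^t\rangle$, and selects $i^t\in M=\arg\max_i(\hat\mu^t_i+p_i^t)$, ties being broken uniformly at random among the members of $M$ with maximal payment. The principal's cost in round $t$ is $p^t_{i^t}$. Information. The agent's history $h^t$ records, for rounds before $t$, the contexts, the payments offered, the arms chosen and the realized rewards. In the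 partial information model the principal observes only the past offered payments and the arms chosen: it observes neither the contexts (past or current) nor the rewards. Round fairness. Let $\pi^t_{j|h}$ be the probability (over the principal's randomization in round $t$ and the agent's tie-breaking) that arm $j$ is selected in round $t$ given history $h^t$ after contexts $x^t$ are observed. The scheme is fair in round $t$ (given $h^t$) if for any contexts $x^t$ and all $j,j'\in[k]$, $\pi^t_{j|h}>\pi^t_{j'|h}$ only if $f_j(x^t_j)>f_{j'}(x^t_{j'})$; otherwise the round is unfair. The probability $1-\delta$ is over the realization of the history. *)

(* Defs.v *)
From HB Require Import structures.
From mathcomp Require Import all_boot all_order all_algebra.
From mathcomp Require Import all_classical all_reals all_analysis.

Set Implicit Arguments.
Unset Strict Implicit.
Unset Printing Implicit Defensive.

Import Order.TTheory GRing.Theory Num.Theory.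

Local Open Scope classical_set_scope.
Local Open Scope ring_scope.

Definition inner (R : realType) (d : nat) (u v : 'cV[R]_d) : R :=
  \sum_(i < d) u i 0 * v i 0.

(* The library norm on matrices is the sup norm, hence this one. *)
Definition euclidean_norm (R : realType) (d : nat) (x : 'cV[R]_d) : R :=
  Num.sqrt (inner x x).

(* Contexts and coefficient vectors range over the same set. *)
Definition context_set (R : realType) (d : nat) : set 'cV[R]_d :=
  [set x : 'cV[R]_d |
    (forall i, 0 <= x i 0 <= 1) /\ euclidean_norm x <= 1].

Notation payment R k := (k.-tuple (measurableTypeR R))%type.

(* A past round as the principal sees it: offered payments and chosen arm.  The
   arm is recorded as its number, nat being equipped by the library with the
   discrete sigma-algebra; only numbers below k occur. *)
Notation principal_round R k := (payment R k * nat)%type.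

(* A past round as the agent sees it: the realized reward is added.  Contexts
   are not repeated here because they are a fixed part of the instance. *)
Notation agent_round R k := (principal_round R k * measurableTypeR R)%type.

Notation prior_rewards R n := (n.-tuple (measurableTypeR R)).

Definition principal_info (R : realType) (k t : nat)
  (h : t.-tuple (agent_round R k)) : t.-tuple (principal_round R k) :=
  map_tuple fst h.

Record payment_scheme (R : realType) (k : nat) := PaymentScheme {
  offer : forall t : nat,
    R.-pker (t.-tuple (principal_round R k)) ~> (payment R k);
  offer_ge0 : forall (t : nat) (info : t.-tuple (principal_round R k)),
    offer t info [set p | forall i : 'I_k, 0 <= (tnth p i : R)] = 1%E }.

(* Before the first round the agent holds n observations, the s-th one
   (s < n) of arm [prior_arm s] in context [prior_context s].  Round t < T uses
   context [context t j] for arm j.  [reward_law j x] is the reward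
   distribution of arm j in context x. *)
Record instance (R : realType) (k d n : nat) (prior_arm : nat -> 'I_k) :=
  Instance {
    theta : 'I_k -> 'cV[R]_d;
    reward_law : 'I_k -> 'cV[R]_d -> probability (measurableTypeR R) R;
    prior_context : nat -> 'cV[R]_d;
    context : nat -> 'I_k -> 'cV[R]_d;
    theta_in : forall j, context_set (theta j);
    prior_context_in : forall s, context_set (prior_context s);
    context_in : forall t j, context_set (context t j);
    reward_law_supp : forall j x, context_set x ->
      reward_law j x [set r : R | 0 <= r <= 1] = 1%E;
    reward_law_mean : forall j x, context_set x ->
      (\int[reward_law j x]_r (r : R)%:E = (inner (theta j) x)%:E)%E;
    prior_full_rank : forall j,
      \sum_(s < n | prior_arm s == j)
        prior_context s *m (prior_context s)^T \in unitmx }.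

Section Interaction.
Variables (R : realType) (k d n : nat) (prior_arm : nat -> 'I_k).
Variables (S : payment_scheme R k) (I : instance R d n prior_arm).

Definition mean_reward (j : 'I_k) (x : 'cV[R]_d) : R := inner (theta I j) x.

Section Estimation.
Variables (t : nat) (w : prior_rewards R n) (h : t.-tuple (agent_round R k)).

Definition chosen (s : 'I_t) : nat := (tnth h s).1.2.
Definition reward (s : 'I_t) : R := (tnth h s).2.

(* Z^T Z and Z^T Y, where the rows of Z and the entries of Y are the contexts
   and the rewards of all observations of arm j available at round t. *)
Definition gram (j : 'I_k) : 'M[R]_d :=
  \sum_(s < n | prior_arm s == j)
     prior_context I s *m (prior_context I s)^T +
  \sum_(s < t | chosen s == j) context I s j *m (context I s j)^T.

Definition moment (j : 'I_k) : 'cV[R]_d :=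
  \sum_(s < n | prior_arm s == j) (tnth w s : R) *: prior_context I s +
  \sum_(s < t | chosen s == j) reward s *: context I s j.

(* [gram j] is always invertible, by [prior_full_rank]. *)
Definition ols (j : 'I_k) : 'cV[R]_d := invmx (gram j) *m moment j.

Definition estimates (x : 'I_k -> 'cV[R]_d) (j : 'I_k) : R :=
  inner (ols j) (x j).

End Estimation.

Definition best_arms (mu : 'I_k -> R) (p : payment R k) : {set 'I_k} :=
  [set i | [forall j, mu j + (tnth p j : R) <= mu i + (tnth p i : R)]].

Definition selectable (mu : 'I_k -> R) (p : payment R k) : {set 'I_k} :=
  [set i in best_arms mu p |
    [forall j in best_arms mu p, (tnth p j : R) <= (tnth p i : R)]].

Definition choice_prob (mu : 'I_k -> R) (p : payment R k) (i : 'I_k) : R :=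
  if i \in selectable mu p then #|selectable mu p|%:R^-1 else 0.

Section Round.
Variables (t : nat) (w : prior_rewards R n) (h : t.-tuple (agent_round R k)).

Definition select_prob (x : 'I_k -> 'cV[R]_d) (j : 'I_k) : \bar R :=
  (\int[offer S t (principal_info h)]_p
     (choice_prob (estimates w h x) p j)%:E)%E.

Definition fair_round : Prop :=
  forall x : 'I_k -> 'cV[R]_d, (forall j, context_set (x j)) ->
  forall j j' : 'I_k, (select_prob x j' < select_prob x j)%E ->
    mean_reward j' (x j') < mean_reward j (x j).

Definition expected_cost : \bar R :=
  (\int[offer S t (principal_info h)]_p
     (\sum_(i < k) choice_prob (estimates w h (context I t)) p i
                   * (tnth p i : R))%:E)%E.

End Round.

(* Expectation of f over the first m prior rewards, which are independent. *)
Fixpoint prior_expectation (m : nat) :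
    (prior_rewards R m -> \bar R) -> \bar R :=
  match m with
  | 0 => fun f => f [tuple]
  | m'.+1 => fun f => prior_expectation (fun w : prior_rewards R m' =>
      (\int[reward_law I (prior_arm m') (prior_context I m')]_r
         f (rcons_tuple w r))%E)
  end.

(* Expectation of f over the history of the first t rounds, given the prior
   rewards w: in each round, integrate in turn over the offered payments, the
   agent's choice and the reward. *)
Fixpoint history_expectation (w : prior_rewards R n) (t : nat) :
    (t.-tuple (agent_round R k) -> \bar R) -> \bar R :=
  match t with
  | 0 => fun f => f [tuple]
  | t'.+1 => fun f =>
      history_expectation w (fun h : t'.-tuple (agent_round R k) =>
        (\int[offer S t' (principal_info h)]_p
           \sum_(i < k)
             (choice_prob (estimates w h (context I t')) p i)%:E *
             \int[reward_law I i (context I t' i)]_r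
                f (rcons_tuple h (p, nat_of_ord i, r)))%E)
  end.

Definition history_prob (T : nat)
    (A : set (prior_rewards R n * T.-tuple (agent_round R k))) : \bar R :=
  prior_expectation (fun w : prior_rewards R n =>
    history_expectation w (fun h : T.-tuple (agent_round R k) =>
      (\1_A (w, h) : R)%:E)).

(* E need not be measurable (fairness quantifies over all contexts), so it is
   required to contain a measurable event of sufficient probability. *)
Definition holds_with_prob (T : nat) (q : R)
    (E : prior_rewards R n -> T.-tuple (agent_round R k) -> Prop) : Prop :=
  exists A : set (prior_rewards R n * T.-tuple (agent_round R k)),
    [/\ measurable A, (forall w h, A (w, h) -> E w h)
      & (q%:E <= history_prob A)%E].

End Interaction.

Definition history_before (X : Type) (T : nat) (h : T.-tuple X) (t : 'I_T) :
    t.-tuple X :=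
  [tuple tnth h (widen_ord (ltnW (ltn_ord t)) s) | s < t].

(* Main.v *)
Require Import Defs.
From HB Require Import structures.
From mathcomp Require Import all_boot all_order all_algebra.
From mathcomp Require Import all_classical all_reals all_analysis.
From mathcomp Require Import measurable_realfun lra.

Import Order.TTheory GRing.Theory Num.Theory.

Local Open Scope classical_set_scope.
Local Open Scope ring_scope.

(** All arms have coefficient vector e_1.  A distinguished arm j0 has
deterministic rewards, so its estimate is exact; every other arm has Bernoulli
rewards and is observed beforehand only in contexts of norm eps, so with
probability at least 1 - n eps all its prior rewards, hence its estimate,
vanish.  In each round j0 is offered the context e_1 and the others the context
0, which never changes any estimate.  The estimated rewards, 1 for j0 and 0 for
the others, are then the same as if every arm had context e_1.  In that
hypothetical situation all true means agree, so fairness forces uniform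
selection; as the payments cannot depend on the contexts, selection is uniform
in the actual round too, and selecting an arm other than j0 costs at least 1. *)

(** * Measurability of finite Boolean conditions *)

Lemma measurable_forallb (d : measure_display) (X : measurableType d)
    (J : finType) (P : J -> X -> bool) :
  (forall j, measurable_fun setT (P j)) ->
  measurable_fun setT (fun x => [forall j, P j x]).
Proof.
move=> mP; apply: (measurable_fun_bool true); rewrite setTI.
rewrite (_ : _ @^-1` _ = \bigcap_(j in [set: J]) (P j @^-1` [set true])).
  apply: fin_bigcap_measurable => [|j _]; first exact: finite_finset.
  by rewrite -[X in measurable X]setTI; exact: mP.
apply/seteqP; split => [x /= /forallP Px j _|x /= Px]; first exact: Px.
by apply/forallP => j; exact: Px.
Qed.

Lemma measurable_indic_bool {R : realType} (d : measure_display)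
    (X : measurableType d) (P : X -> bool) :
  measurable_fun setT P ->
  measurable_fun setT (fun x => (P x)%:R : measurableTypeR R).
Proof.
move=> mP.
by apply: (measurableT_comp (f := fun b : bool => (b%:R : measurableTypeR R))).
Qed.

(** * The agent's choice rule as a measurable function of the payments *)

Section Choice.
Context {R : realType} {k : nat} (mu : 'I_k -> R).
Implicit Types (p : payment R k) (i j : 'I_k).

Lemma measurable_best_arms i :
  measurable_fun setT (fun p => i \in best_arms mu p).
Proof.
under eq_fun do rewrite inE.
apply: measurable_forallb => j; apply: measurable_fun_ler;
  by apply: measurable_funD => //; exact: measurable_tnth.
Qed.

Lemma measurable_selectable i :
  measurable_fun setT (fun p => i \in selectable mu p).
Proof.
under eq_fun do rewrite inE.
apply: measurable_and; first exact: measurable_best_arms.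
apply: measurable_forallb => j.
under eq_fun do rewrite implybE.
apply: measurable_or; last by apply: measurable_fun_ler; exact: measurable_tnth.
by apply: measurable_neg; exact: measurable_best_arms.
Qed.

Lemma choice_probE p i : choice_prob mu p i =
  (i \in selectable mu p)%:R * (#|selectable mu p|%:R)^-1.
Proof. by rewrite /choice_prob; case: ifP; rewrite ?mul1r ?mul0r. Qed.

Lemma measurable_choice_prob i :
  measurable_fun setT (fun p => choice_prob mu p i : measurableTypeR R).
Proof.
under eq_fun do rewrite choice_probE -sum1_card big_mkcond /=.
apply: measurable_funM.
  by apply: measurable_indic_bool; exact: measurable_selectable.
(* The domain [nat] is discrete, so taking the inverse is measurable; what remains is the
   cardinality, now a sum of indicators. *)
apply: (measurableT_comp
  (f := fun m : nat => ((m%:R : R)^-1 : measurableTypeR R))) => //.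
elim: (index_enum _) => [|j s IH].
  rewrite (_ : (fun _ => _) = cst 0%N); first exact: measurable_cst.
  by apply/funext => p; rewrite big_nil.
rewrite (_ : (fun _ => _) = (fun p : payment R k =>
    ((if j \in selectable mu p then 1 else 0) +
     \sum_(l <- s) (if l \in selectable mu p then 1 else 0))%N)); last first.
  by apply/funext => p; rewrite big_cons.
apply: measurable_fun_addn => //.
apply: measurable_fun_ifT => //; exact: measurable_selectable.
Qed.

Lemma choice_prob_ge0 p i : 0 <= choice_prob mu p i.
Proof. by rewrite choice_probE mulr_ge0 ?invr_ge0. Qed.

(** [selectable] is nonempty: maximize estimate plus payment, then the payment among the maximizers.
    Its uniform weights therefore add up to one. *)
Lemma sum_choice_prob p : (0 < k)%N -> \sum_(i < k) choice_prob mu p i = 1.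
Proof.
move=> k0; pose i0 : 'I_k := Ordinal k0.
case: (@Order.TotalTheory.arg_maxP _ _ _ i0 xpredT
  (fun i => mu i + (tnth p i : R)) isT) => b _ bP.
have bB : b \in best_arms mu p by rewrite inE; apply/forallP => j; exact: bP.
case: (@Order.TotalTheory.arg_maxP _ _ _ b (mem (best_arms mu p))
  (fun i => (tnth p i : R)) bB) => c cB cP.
have cS : c \in selectable mu p.
  rewrite inE; apply/andP; split; first exact: cB.
  by apply/forallP => j; apply/implyP; exact: cP.
rewrite -big_mkcond /= sumr_const -[LHS]mulr_natr mulVf // pnatr_eq0 -lt0n.
by apply/card_gt0P; exists c.
Qed.

End Choice.

(** * Expected cost of uniform selection under a fixed payment law *)

Section Cost.
Context {R : realType} {k : nat} (P : {measure set (payment R k) -> \bar R}).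
Hypothesis P1 : P setT = 1%E.
Implicit Types (mu : 'I_k -> R) (i j : 'I_k).

Let choice_mass mu i := (\int[P]_p (choice_prob mu p i)%:E)%E.

Let measurable_choice mu i :
  measurable_fun setT (fun p : payment R k => (choice_prob mu p i)%:E).
Proof. by apply/measurable_EFinP; exact: measurable_choice_prob. Qed.

Lemma uniform_choice_mass mu : (0 < k)%N ->
  (forall i j, choice_mass mu i = choice_mass mu j) ->
  forall i, choice_mass mu i = (k%:R^-1)%:E.
Proof.
move=> k0 eq_mass i.
have : (\sum_(j < k) choice_mass mu j = 1)%E.
  rewrite /choice_mass -ge0_integral_sum//=; last first.
    by move=> j p _; rewrite lee_fin choice_prob_ge0.
  under eq_integral do rewrite sumEFin sum_choice_prob //.
  by rewrite integral_cst// mul1e P1.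
(* The common mass is not yet known to be finite, so it is factored out of the sum, with
   coefficients 1, and the equation is multiplied by [k%:R^-1]. *)
under eq_bigr do rewrite (eq_mass _ i) -[choice_mass mu i]mul1e.
rewrite -ge0_sume_distrl// sumEFin sumr_const card_ord.
move=> /(congr1 (fun x => (k%:R^-1)%:E * x)%E).
rewrite mule1 muleA -EFinM mulVf ?mul1e//.
by rewrite pnatr_eq0 -lt0n.
Qed.

(** Another arm can beat [j0] only if its payment makes up a gap of at least 1; as the payment of
    [j0] is nonnegative, the arm is paid at least 1. Each of the [k.-1] such arms has mass
    [k%:R^-1]. *)
Lemma expected_payment_ge mu j0 :
  P [set p | forall i : 'I_k, 0 <= (tnth p i : R)] = 1%E ->
  (forall i, i != j0 -> mu i + 1 <= mu j0) ->
  (forall i j, choice_mass mu i = choice_mass mu j) ->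
  ((k.-1%:R / k%:R)%:E <=
    \int[P]_p (\sum_(i < k) choice_prob mu p i * (tnth p i : R))%:E)%E.
Proof.
move=> P0 gap eq_mass; set N := [set p | _] in P0.
have k0 : (0 < k)%N := leq_ltn_trans (leq0n _) (ltn_ord j0).
have mN : measurable N.
  rewrite (_ : N =
      (fun p : payment R k => [forall i, 0 <= (tnth p i : R)]) @^-1` [set true]).
    rewrite -[X in measurable X]setTI.
    suff: measurable_fun [set: payment R k]
      (fun p => [forall i, 0 <= (tnth p i : R)]) by exact.
    apply: measurable_forallb => i; apply: measurable_fun_ler => //.
    exact: measurable_tnth.
  by apply/seteqP; split => p /= /forallP.
(* [g] is the conditional probability of selecting an arm other than [j0]; its integral is the
   claimed bound. *)
pose g (p : payment R k) := \sum_(i < k | i != j0) choice_prob mu p i.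
pose f (p : payment R k) := \sum_(i < k) choice_prob mu p i * (tnth p i : R).
have mf : measurable_fun setT (EFin \o f).
  apply/measurable_EFinP; apply: measurable_sum => i.
  apply: measurable_funM; [exact: measurable_choice_prob|exact: measurable_tnth].
have mg : measurable_fun setT (EFin \o g).
  apply/measurable_EFinP.
  rewrite (_ : g = fun p => \sum_(i <- [seq i <- index_enum 'I_k | i != j0])
      choice_prob mu p i); last by apply/funext => p; rewrite big_filter.
  by apply: measurable_sum => i; exact: measurable_choice_prob.
have -> : ((k.-1%:R / k%:R)%:E = \int[P]_p (g p)%:E)%E.
  transitivity (\int[P]_p \sum_(i <- [seq i <- index_enum 'I_k | i != j0])
      (choice_prob mu p i)%:E)%E; last first.
    by apply: eq_integral => p _; rewrite big_filter sumEFin.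
  rewrite ge0_integral_sum//=; last first.
    by move=> j p _; rewrite lee_fin choice_prob_ge0.
  rewrite big_filter.
  rewrite (eq_bigr (fun=> (k%:R^-1)%:E)); last first.
    by move=> i _; exact: uniform_choice_mass eq_mass i.
  rewrite sumEFin sumr_const (_ : #|_| = k.-1) ?mulr_natl //.
  by rewrite cardC1 card_ord.
(* Payments are nonnegative only almost surely. Replacing the cost by [g] off [N] keeps the integral
   and makes [g] a lower bound at every point. *)
pose f' p := if p \in N then (f p)%:E else (g p)%:E.
have mf' : measurable_fun setT f'.
  apply: measurable_fun_ifT => //.
  apply: (measurable_fun_bool true); rewrite setTI.
  rewrite (_ : _ @^-1` _ = N) //.
  by apply/seteqP; split => p /=; [exact: set_mem|exact: mem_set].
rewrite [leRHS](_ : _ = (\int[P]_p f' p)%E); last first.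
  apply: ae_eq_integral => //; exists (~` N); split; first exact: measurableC.
    have : (P N + P (~` N) = 1)%E.
      have := measureU P mN (measurableC mN) (setICr N).
      by rewrite setUv => <-; exact: P1.
    rewrite P0; case: (P _) => [r [] /(canRL (addKr _))|//|//] ->.
    by rewrite addNr.
  by apply: subsetC => p pN _; rewrite /f' mem_set.
apply: ge0_le_integral => //.
  by move=> p _; rewrite lee_fin sumr_ge0// => i _; exact: choice_prob_ge0.
move=> p _; rewrite /f'; case: ifPn => // /set_mem pN.
rewrite lee_fin /g /f [leRHS](bigD1 j0)//= -[leLHS]add0r lerD//.
  by rewrite mulr_ge0 ?choice_prob_ge0.
apply: ler_sum => i ij0; rewrite /choice_prob.
case: ifP => [|_]; last by rewrite mul0r.
rewrite !inE => /andP[/forallP/(_ j0) best _].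
rewrite ler_peMr ?invr_ge0 ?ler0n//.
have := gap _ ij0; have := pN j0; lra.
Qed.

End Cost.

(** Splits off the last entry, in step with the recursions that define the expectations. *)
Lemma forall_tnth_rcons (X : Type) (m : nat) (Q : nat -> X -> bool)
    (h : m.-tuple X) (x : X) :
  [forall s : 'I_m.+1, Q s (tnth (rcons_tuple h x) s)] =
  [forall s : 'I_m, Q s (tnth h s)] && Q m x.
Proof.
have lastE : tnth (rcons_tuple h x) ord_max = x.
  by rewrite (tnth_nth x) /= nth_rcons size_tuple ltnn eqxx.
have initE (s : 'I_m) :
    tnth (rcons_tuple h x) (widen_ord (leqnSn m) s) = tnth h s.
  by rewrite !(tnth_nth x) /= nth_rcons size_tuple ltn_ord.
apply/forallP/andP => [hQ|[/forallP hQ Qx] s].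
  split; last by rewrite -[x in Q _ x]lastE; exact: (hQ ord_max).
  by apply/forallP => s; rewrite -initE; exact: (hQ (widen_ord (leqnSn m) s)).
have [sm|] := ltnP s m.
  rewrite (_ : s = widen_ord (leqnSn m) (Ordinal sm)); last exact: val_inj.
  by rewrite initE; exact: (hQ (Ordinal sm)).
move=> ms; have sE : s = ord_max.
  by apply/val_inj/eqP; rewrite /= eqn_leq ms andbT -ltnS.
by rewrite sE lastE.
Qed.

(** * Probabilities of events that constrain each entry separately *)

Section Independence.
Context {R : realType} {k d n : nat} {prior_arm : nat -> 'I_k}.
Variables (S : payment_scheme R k) (I : instance R d n prior_arm).

(** Independence turns the probability into a product. The constant [c] is general so that the
    factor [q m] of the innermost integral can be absorbed into it before the induction hypothesis
    is applied. *)
Lemma prior_expectation_forall (Q : nat -> R -> bool) (q : nat -> R) (c : R)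
    (m : nat) :
  0 <= c -> (forall s, 0 <= q s) ->
  (forall s, measurable [set r : measurableTypeR R | Q s r]) ->
  (forall s, reward_law I (prior_arm s) (prior_context I s)
    [set r : measurableTypeR R | Q s r] = (q s)%:E) ->
  prior_expectation I (fun w : prior_rewards R m =>
     (c * [forall s : 'I_m, Q s (tnth w s)]%:R)%:E) = (c * \prod_(s < m) q s)%:E.
Proof.
move=> c0 q0 mQ Qq; elim: m c c0 => [|m IH] c c0 /=.
  by rewrite big_ord0 (_ : [forall _, _] = true) //; apply/forallP => -[].
rewrite big_ord_recr /= mulrA mulrAC -IH ?mulr_ge0//.
congr prior_expectation; apply/funext => w.
under eq_integral do rewrite forall_tnth_rcons -mulnb natrM mulrA EFinM.
rewrite ge0_integralZl_EFin ?mulr_ge0//.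
  rewrite (_ : (fun r => _) =
      fun r => ((\1_[set r | Q m r] r : R)%:E)); last first.
    apply/funext => r; rewrite indicE.
    by congr ((nat_of_bool _)%:R%:E); apply/idP/idP => [/mem_set|/set_mem].
  by rewrite integral_indic// setIT [X in (_ * X)%E]Qq -EFinM mulrAC.
apply/measurable_EFinP/measurable_indic_bool.
by apply: (measurable_fun_bool true); rewrite setTI; exact: mQ.
Qed.

(** Whatever is offered and chosen, the new reward satisfies [Q] almost surely; choice probabilities
    sum to one and offers have total mass one, so each round contributes a factor 1. *)
Lemma history_expectation_forall (w : prior_rewards R n)
    (Q : agent_round R k -> bool) (c : R) (t : nat) :
  (0 < k)%N -> 0 <= c ->
  (forall p i, measurable [set r : measurableTypeR R | Q (p, i, r)]) ->
  (forall s p i, reward_law I i (context I s i)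
    [set r : measurableTypeR R | Q (p, nat_of_ord i, r)] = 1%E) ->
  history_expectation S I w (fun h : t.-tuple (agent_round R k) =>
     (c * [forall s : 'I_t, Q (tnth h s)]%:R)%:E) = (c%:E : \bar R).
Proof.
move=> k0 c0 mQ Q1; elim: t => [|t IH] /=.
  by rewrite (_ : [forall _, _] = true) ?mulr1 //; apply/forallP => -[].
rewrite -[RHS]IH; congr history_expectation; apply/funext => h.
transitivity (\int[offer S t (principal_info h)]_p
    cst (c * [forall s : 'I_t, Q (tnth h s)]%:R)%:E p)%E; last first.
  by rewrite integral_cst// prob_kernel mule1.
apply: eq_integral => p _ /=; rewrite -[RHS]mul1e.
rewrite [X in (X * _)%E](_ : _ = \sum_(i < k)
    (choice_prob (estimates I w h (context I t)) p i)%:E)%E; last first.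
  by rewrite sumEFin sum_choice_prob.
rewrite ge0_sume_distrl; last by move=> i _; rewrite lee_fin choice_prob_ge0.
apply: eq_bigr => i _; congr (_ * _)%E.
under eq_integral do
  rewrite (forall_tnth_rcons _ _ (fun=> Q)) -mulnb natrM mulrA EFinM.
rewrite ge0_integralZl_EFin ?mulr_ge0//.
  rewrite (_ : (fun r => _) =
      fun r => ((\1_[set r | Q (p, nat_of_ord i, r)] r : R)%:E)); last first.
    apply/funext => r; rewrite indicE.
    by congr ((nat_of_bool _)%:R%:E); apply/idP/idP => [/mem_set|/set_mem].
  by rewrite integral_indic// setIT [X in (_ * X)%E]Q1 mule1.
apply/measurable_EFinP/measurable_indic_bool.
by apply: (measurable_fun_bool true); rewrite setTI; exact: mQ.
Qed.

End Independence.

(** * Bernoulli laws as laws on the real line *)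

Section BernoulliReward.
Context {R : realType}.

(** Named so that it can carry the measurable function structure used to form the image law. *)
Definition bit_reward (b : bool) : measurableTypeR R := b%:R.

Let measurable_bit_reward : measurable_fun setT bit_reward.
Proof. by []. Qed.

HB.instance Definition _ :=
  isMeasurableFun.Build _ _ _ _ bit_reward measurable_bit_reward.

Definition bernoulli_reward (p : R) : probability (measurableTypeR R) R :=
  distribution (bernoulli_prob p) bit_reward.

Lemma bernoulli_reward_supp (p : R) :
  bernoulli_reward p [set r : R | 0 <= r <= 1] = 1%E.
Proof.
rewrite /= /distribution /pushforward.
rewrite (_ : _ @^-1` _ = setT) ?probability_setT//.
by apply/seteqP; split => // -[] _; rewrite /bit_reward /= ?lexx ?ler01.
Qed.

Lemma bernoulli_reward0 (p : R) : 0 <= p <= 1 ->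
  bernoulli_reward p [set r : R | r == 0] = (1 - p)%:E.
Proof.
move=> p01; rewrite /= /distribution /pushforward bernoulli_probE//.
rewrite !diracE memNset ?mem_set ?mule0 ?add0e ?mule1//=.
by rewrite /bit_reward /= => /eqP; exact/eqP/oner_neq0.
Qed.

Lemma integral_bernoulli_reward (p : R) : 0 <= p <= 1 ->
  (\int[bernoulli_reward p]_r (r : R)%:E = p%:E)%E.
Proof.
move=> p01.
have bit_ge0 b : (0 <= (bit_reward b : R)%:E)%E by rewrite lee_fin ler0n.
have integral_bit : (\int[bernoulli_prob p]_b (bit_reward b : R)%:E = p%:E)%E.
  by rewrite integral_bernoulli_prob//= mule1 mule0 adde0.
rewrite integral_distribution; [exact: integral_bit| |].
  by apply/measurable_EFinP; exact: measurable_id.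
apply/integrableP; split.
  by apply/measurable_EFinP; exact: measurable_bit_reward.
rewrite (eq_integral (fun b => (bit_reward b : R)%:E)); last first.
  by move=> b _; apply: gee0_abs; exact: bit_ge0.
by rewrite integral_bit ltry.
Qed.

End BernoulliReward.

(** * Sums of outer products and their quadratic forms *)

Section OLS.
Context {R : realType} {d : nat}.
Implicit Types (u : 'rV[R]_d) (v x : 'cV[R]_d).

Lemma outer_mulmx x v : x *m x^T *m v = inner v x *: x.
Proof.
rewrite -mulmxA [x^T *m v]mx11_scalar mul_mx_scalar; congr (_ *: _).
by rewrite mxE; apply: eq_bigr => i _; rewrite mxE mulrC.
Qed.

Lemma sum_outer_quad {J : finType} (P : pred J) (x : J -> 'cV[R]_d) u :
  (u *m (\sum_(s | P s) x s *m (x s)^T) *m u^T) 0 0 =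
  \sum_(s | P s) ((u *m x s) 0 0) ^+ 2.
Proof.
rewrite mulmx_sumr mulmx_suml summxE; apply: eq_bigr => s _.
rewrite mulmxA -[u *m x s *m _ *m _]mulmxA -trmx_mul.
set y := u *m x s.
by rewrite mxE big_ord1 [y^T _ _]mxE expr2.
Qed.

(** A kernel vector makes the quadratic form, a sum of squares, vanish, so it annihilates every
    [x s]. *)
Lemma sum_outer_unitmx {J : finType} (P : pred J) (x : J -> 'cV[R]_d) :
  (forall u, (forall s, P s -> u *m x s = 0) -> u = 0) ->
  \sum_(s | P s) x s *m (x s)^T \in unitmx.
Proof.
move=> x_full; rewrite -row_free_unit; apply: inj_row_free => u uM0.
apply: x_full => s Ps; apply/matrixP => a b; rewrite !ord1 [RHS]mxE.
have := sum_outer_quad P x u; rewrite uM0 mul0mx mxE => /esym/eqP.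
rewrite psumr_eq0 => [/allP/(_ s)|i _]; last exact: sqr_ge0.
by rewrite mem_index_enum Ps sqrf_eq0 => /(_ isT)/eqP.
Qed.

End OLS.

(** * Least squares estimates from perfectly fitted data *)

Section Estimates.
Context {R : realType} {k d n : nat} {prior_arm : nat -> 'I_k}.
Variables (I : instance R d n prior_arm) (t : nat).
Variables (w : prior_rewards R n) (h : t.-tuple (agent_round R k)).

(** Prior and later observations both contribute nonnegative quadratic forms, so a kernel vector of
    the sum is already one of the prior part, which is invertible. *)
Lemma gram_unitmx j : gram I h j \in unitmx.
Proof.
rewrite -row_free_unit; apply: inj_row_free => u uG0.
have prior_quad0 : (u *m (\sum_(s < n | prior_arm s == j)
    prior_context I s *m (prior_context I s)^T) *m u^T) 0 0 = 0.
  have : (u *m gram I h j *m u^T) 0 0 = 0 by rewrite uG0 mul0mx mxE.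
  rewrite mulmxDr mulmxDl mxE !sum_outer_quad => /eqP.
  rewrite paddr_eq0; last 2 first.
  - by apply: sumr_ge0 => s _; exact: sqr_ge0.
  - by apply: sumr_ge0 => s _; exact: sqr_ge0.
  by case/andP => /eqP.
have Pu := prior_full_rank I j.
rewrite -[u](mulmxK Pu) (_ : u *m _ = 0) ?mul0mx// mulmx_sumr big1// => s sj.
move: prior_quad0; rewrite sum_outer_quad => /eqP.
rewrite psumr_eq0 => [/allP/(_ s)|i _]; last exact: sqr_ge0.
rewrite mem_index_enum sj sqrf_eq0 => /(_ isT)/eqP ux0.
rewrite mulmxA (_ : u *m _ = 0) ?mul0mx//.
by apply/matrixP => a b; rewrite !ord1 ux0 mxE.
Qed.

(* The fit is only required after multiplication by the context, so that rewards
   observed in the context 0 are unconstrained. *)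
Lemma ols_eq j v :
  (forall s : 'I_n, prior_arm s == j ->
     (tnth w s : R) *: prior_context I s =
     inner v (prior_context I s) *: prior_context I s) ->
  (forall s : 'I_t, chosen h s == j ->
     reward h s *: context I s j = inner v (context I s j) *: context I s j) ->
  ols I w h j = v.
Proof.
move=> prior_fit round_fit.
rewrite -[RHS](mulKmx (gram_unitmx j)); congr (_ *m _).
rewrite /moment mulmxDl !mulmx_suml; congr (_ + _); apply: eq_bigr => s sj.
  by rewrite outer_mulmx prior_fit.
by rewrite outer_mulmx round_fit.
Qed.

End Estimates.

(** * Multiples of coordinate vectors *)

Section Axis.
Context {R : realType} {d : nat}.

Definition axis (a : R) (i : 'I_d) : 'cV[R]_d := a *: delta_mx i 0.

Lemma axisE a i l m : axis a i l m = a * (l == i)%:R.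
Proof. by rewrite !mxE [m]ord1 eqxx andbT. Qed.

Lemma inner_axis a i v : inner (axis a i) v = a * v i 0.
Proof.
rewrite /inner (bigD1 i)//= axisE eqxx mulr1 big1 ?addr0// => l /negbTE li.
by rewrite axisE li mulr0 mul0r.
Qed.

Lemma axis_context a i : 0 <= a <= 1 -> context_set (axis a i).
Proof.
case/andP => a0 a1; split => [l|].
  by rewrite axisE; case: (l == i); rewrite ?mulr1 ?mulr0 ?a0 ?a1 ?lexx ?ler01.
by rewrite /euclidean_norm inner_axis axisE eqxx mulr1 -expr2 sqrtr_sqr ger0_norm.
Qed.

End Axis.

(** The count grows by at most one per step, so no value is skipped. This finds the observation of
    an arm with a given rank, counted from 0. *)
Lemma count_iota_surj (P : pred nat) (n i : nat) :
  (i < count P (iota 0 n))%N ->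
  exists2 s, (s < n)%N & P s /\ count P (iota 0 s) = i.
Proof.
elim: n => [//|n IH]; rewrite -[n.+1]addn1 iotaD count_cat /= addn0 add0n.
have [/IH[s sn Ps] _|ni] := ltnP i (count P (iota 0 n)).
  by exists s => //; rewrite addn1 ltnS ltnW.
case: (boolP (P n)) => Pn ilt.
  exists n; first by rewrite addn1.
  by split => //; apply/eqP; rewrite eqn_leq ni -ltnS (leq_trans ilt)// addn1.
by move: ilt; rewrite addn0 ltnNge ni.
Qed.

(** Bernoulli's inequality for equal factors [1 - e], followed by a factorwise comparison. *)
Lemma prod_ge_subr_sum (R : realType) (e : R) (q : nat -> R) (n : nat) :
  0 <= e <= 1 -> (forall s, 1 - e <= q s) -> 1 - n%:R * e <= \prod_(s < n) q s.
Proof.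
move=> /andP[e0 e1] eq; apply: (@le_trans _ _ ((1 - e) ^+ n)).
  elim: n => [|n IH]; first by rewrite mul0r subr0 expr0.
  rewrite exprSr; apply: le_trans (ler_wpM2r _ IH); last by rewrite subr_ge0.
  rewrite -natr1; have : 0 <= n%:R * (e * e) by rewrite !mulr_ge0.
  lra.
rewrite -[n in _ ^+ n]card_ord -prodr_const; apply: ler_prod => s _.
by rewrite subr_ge0 e1 eq.
Qed.

(** * The hard instance *)

Section Construction.
Context {R : realType} {k d n : nat} (prior_arm : nat -> 'I_k).
Variables (j0 : 'I_k) (i0 : 'I_d) (e : R).
Hypothesis e01 : 0 < e <= 1.
Hypothesis enough_prior :
  forall j : 'I_k, (d <= #|[pred s : 'I_n | prior_arm s == j]|)%N.

Lemma direction_subproof s :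
  (count (fun r => prior_arm r == prior_arm s) (iota 0 s) %% d < d)%N.
Proof. by rewrite ltn_mod (leq_trans _ (ltn_ord i0)). Qed.

(* Cycling through the axes makes the Gram matrix of each arm invertible as soon
   as the arm has d prior observations. *)
Definition direction s : 'I_d := Ordinal (direction_subproof s).

Definition hard_theta (j : 'I_k) : 'cV[R]_d := axis 1 i0.

(** Only the coordinate [i0] matters: it is the mean, since every coefficient vector is
    [axis 1 i0]. *)
Definition hard_law (j : 'I_k) (x : 'cV[R]_d) :
    probability (measurableTypeR R) R :=
  if j == j0
  then [the probability _ _ of \d_(x i0 0 : measurableTypeR R)]
  else bernoulli_reward (x i0 0).

Definition hard_prior_context s : 'cV[R]_d := axis e (direction s).

Definition hard_context (t : nat) (j : 'I_k) : 'cV[R]_d := axis (j == j0)%:R i0.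

Lemma hard_theta_in j : context_set (hard_theta j).
Proof. by apply: axis_context; rewrite ler01 lexx. Qed.

Lemma hard_prior_context_in s : context_set (hard_prior_context s).
Proof. by apply: axis_context; case/andP: e01 => /ltW -> ->. Qed.

Lemma hard_context_in t j : context_set (hard_context t j).
Proof. by apply: axis_context; case: eqP; rewrite ?ler01 ?lexx. Qed.

Lemma hard_law_supp j x : context_set x ->
  hard_law j x [set r : R | 0 <= r <= 1] = 1%E.
Proof.
case=> x01 _; rewrite /hard_law; case: ifP => _.
  have x_in : [set r : R | 0 <= r <= 1] (x i0 0) by exact: x01.
  by rewrite /= diracE (mem_set x_in).
exact: bernoulli_reward_supp.
Qed.

Lemma hard_law_mean j x : context_set x ->
  (\int[hard_law j x]_r (r : R)%:E = (inner (hard_theta j) x)%:E)%E.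
Proof.
case=> x01 _; rewrite inner_axis mul1r /hard_law; case: ifP => _.
  by rewrite integral_dirac ?diracT ?mul1e//.
by apply: integral_bernoulli_reward; exact: x01.
Qed.

(** The observation of arm [j] of rank [i < d] points along axis [i], so a vector orthogonal to all
    its prior contexts has every coordinate zero, as [e] is nonzero. *)
Lemma hard_prior_full_rank j :
  \sum_(s < n | prior_arm s == j)
    hard_prior_context s *m (hard_prior_context s)^T \in unitmx.
Proof.
apply: (sum_outer_unitmx (fun s : 'I_n => prior_arm s == j)
  (fun s : 'I_n => hard_prior_context s)) => u u0.
apply/rowP => i; rewrite mxE.
have [s sn [/eqP sj si]] : exists2 s, (s < n)%N &
    prior_arm s == j /\ count (fun r => prior_arm r == j) (iota 0 s) = i.
  apply: count_iota_surj.
  apply: leq_trans (ltn_ord i) (leq_trans (enough_prior j) _).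
  rewrite cardE /enum_mem size_filter.
  rewrite -(count_map val (fun r => prior_arm r == j)).
  by rewrite -enumT val_enum_ord.
have dirE : direction s = i.
  by apply: val_inj; rewrite /= sj si modn_small.
have /(congr1 (fun M : 'M[R]_(1, 1) => M 0 0)) := u0 (Ordinal sn) (introT eqP sj).
rewrite mxE (bigD1 i)//= axisE dirE eqxx mulr1.
rewrite big1 => [|l /negbTE li]; last first.
  by rewrite axisE dirE li !mulr0.
rewrite addr0 mxE => /eqP; rewrite mulf_eq0 => /orP[/eqP//|].
by case/andP: e01 => /lt0r_neq0/negbTE ->.
Qed.

Definition hard_instance : instance R d n prior_arm :=
  Instance hard_theta_in hard_prior_context_in hard_context_in
    hard_law_supp hard_law_mean hard_prior_full_rank.

Definition good_prior_reward (s : nat) (r : R) : bool :=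
  r == if prior_arm s == j0 then hard_prior_context s i0 0 else 0.

(** The value 1 is the mean of [j0] in its actual context. Other arms are left free: their context
    is 0, so their rewards do not enter the moment. *)
Definition good_round (r : agent_round R k) : bool :=
  (r.1.2 == j0) ==> (r.2 == 1 :> R).

(** * Estimates and cost on good histories *)

Section GoodHistory.
Context {t : nat} (w : prior_rewards R n) (h : t.-tuple (agent_round R k)).
Hypothesis good_w : forall s : 'I_n, good_prior_reward s (tnth w s).
Hypothesis good_h : forall s : 'I_t, good_round (tnth h s).

Lemma hard_ols j : ols hard_instance w h j = axis (j == j0)%:R i0.
Proof.
apply: ols_eq => s.
  move=> sj; have /eqP -> := good_w s; rewrite (eqP sj) inner_axis.
  by case: (j == j0); rewrite ?mul1r ?mul0r.
move=> sj; rewrite inner_axis /= axisE eqxx mulr1.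
have := good_h s; rewrite /good_round /reward.
have [jj0|/negbTE jj0] := eqVneq j j0; last first.
  by rewrite /= /hard_context /axis jj0 !scale0r !scaler0.
by rewrite -jj0 (_ : (tnth h s).1.2 == j) //= => /eqP ->; rewrite mulr1.
Qed.

Lemma hard_estimates x j :
  estimates hard_instance w h x j = (j == j0)%:R * x j i0 0.
Proof. by rewrite /estimates hard_ols inner_axis. Qed.

(** At the probe contexts [axis 1 i0] all true means agree, so fairness excludes any strict
    inequality between selection probabilities. The actual contexts give the same estimates [mu]
    under the same payment law, so this uniformity carries over. *)
Lemma hard_round (S : payment_scheme R k) :
  fair_round S hard_instance w h ->
  ((k.-1%:R / k%:R)%:E <= expected_cost S hard_instance w h)%E.
Proof.
move=> fair; pose mu j := (j == j0)%:R : R.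
have probeE : estimates hard_instance w h (fun=> axis 1 i0) = mu.
  by apply/funext => j; rewrite hard_estimates axisE eqxx !mulr1.
have actualE : estimates hard_instance w h (context hard_instance t) = mu.
  apply/funext => j; rewrite hard_estimates /= axisE eqxx mulr1 /mu.
  by case: (j == j0); rewrite ?mulr0 ?mulr1.
have probe_in (j : 'I_k) : context_set (axis 1 i0 : 'cV[R]_d).
  by apply: axis_context; rewrite ler01 lexx.
have le_mass i j : (select_prob S hard_instance w h (fun=> axis 1 i0) i <=
    select_prob S hard_instance w h (fun=> axis 1 i0) j)%E.
  by rewrite leNgt; apply/negP => /(fair _ probe_in); rewrite ltxx.
rewrite /expected_cost actualE.
apply: (expected_payment_ge (offer S t (principal_info h)) _ mu j0).
- exact: prob_kernel.
- exact: offer_ge0.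
- by move=> i /negbTE ij0; rewrite /mu ij0 eqxx add0r.
- move=> i j; have := conj (le_mass i j) (le_mass j i).
  by rewrite /select_prob probeE => -[ij ji]; apply/eqP; rewrite eq_le ij ji.
Qed.

End GoodHistory.

(** Given any prior rewards, all rounds are good with probability one, so only the product over the
    prior rewards remains. *)
Lemma hard_probability (S : payment_scheme R k) (T : nat) :
  ((1 - n%:R * e)%:E <= history_prob S hard_instance (T := T)
     [set wh | [forall s : 'I_n, good_prior_reward s (tnth wh.1 s)] &&
               [forall s : 'I_T, good_round (tnth wh.2 s)]])%E.
Proof.
have k0 : (0 < k)%N := leq_ltn_trans (leq0n _) (ltn_ord j0).
have [e0 e1] := andP e01.
have measurable1 (a : R) : measurable [set r : measurableTypeR R | r == a].
  rewrite (_ : [set _ | _] = [set a]); first exact: measurable_set1.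
  by apply/seteqP; split => r /= /eqP.
pose q s := if prior_arm s == j0 then 1 else 1 - hard_prior_context s i0 0.
(* The coordinate is [e] along [i0] and 0 along every other axis. *)
have context01 s : 0 <= hard_prior_context s i0 0 <= e.
  by rewrite axisE; case: eqP; rewrite ?mulr1 ?mulr0 ?lexx ltW.
have q_ge s : 1 - e <= q s.
  by rewrite /q; case: ifP => _; have /andP[? ?] := context01 s; lra.
rewrite /history_prob (_ : (fun w => _) = fun w : prior_rewards R n =>
    (1 * [forall s : 'I_n, good_prior_reward s (tnth w s)]%:R)%:E); last first.
  apply/funext => w; rewrite mul1r.
  rewrite -[RHS](history_expectation_forall S hard_instance w good_round _ T)//.
  - congr history_expectation; apply/funext => h.
    rewrite indicE -natrM mulnb; congr ((nat_of_bool _)%:R%:E).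
    by apply/idP/idP => [/set_mem|/mem_set].
  - move=> p i; rewrite /good_round /=; case: (i == j0 :> nat) => /=.
      exact: measurable1.
    by rewrite (_ : [set _ | _] = setT) //; apply/seteqP.
  - move=> s p i; rewrite /= /hard_law /good_round /= -val_eqE /=.
    case: eqP => [ij0|_] /=.
      rewrite /hard_context axisE (_ : i == j0) ?eqxx ?mulr1; last first.
        exact/eqP/val_inj.
      by rewrite diracE mem_set//= eqxx.
    by rewrite (_ : [set _ | _] = setT) ?probability_setT //; apply/seteqP.
rewrite (prior_expectation_forall hard_instance good_prior_reward q)//.
- rewrite mul1r lee_fin; apply: prod_ge_subr_sum => //.
  by rewrite (ltW e0).
- by move=> s; apply: le_trans (q_ge s); rewrite subr_ge0.
- by move=> s; exact: measurable1.
- move=> s; rewrite /good_prior_reward /= /hard_law /q; case: ifP => _.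
    by rewrite /= diracE mem_set//= eqxx.
  apply: bernoulli_reward0; have /andP[-> ce] := context01 s.
  exact: le_trans e1.
Qed.

Lemma measurable_good_event (T : nat) : measurable
  [set wh : prior_rewards R n * T.-tuple (agent_round R k) |
    [forall s : 'I_n, good_prior_reward s (tnth wh.1 s)] &&
    [forall s : 'I_T, good_round (tnth wh.2 s)]].
Proof.
pose b (wh : prior_rewards R n * T.-tuple (agent_round R k)) :=
  [forall s : 'I_n, good_prior_reward s (tnth wh.1 s)] &&
  [forall s : 'I_T, good_round (tnth wh.2 s)].
rewrite (_ : [set _ | _] = b @^-1` [set true]) //.
suff mb : measurable_fun setT b by rewrite -[X in measurable X]setTI; exact: mb.
apply: measurable_and; apply: measurable_forallb => s.
  apply: measurable_fun_eqr => //.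
  exact: measurableT_comp (measurable_tnth s) measurable_fst.
have mround : measurable_fun setT
    (fun wh : prior_rewards R n * T.-tuple (agent_round R k) => tnth wh.2 s).
  exact: measurableT_comp (measurable_tnth s) measurable_snd.
rewrite (_ : (fun _ => _) =
  (fun wh : prior_rewards R n * T.-tuple (agent_round R k) =>
    ~~ ((tnth wh.2 s).1.2 == j0) || ((tnth wh.2 s).2 == 1 :> R))); last first.
  by apply/funext => wh; rewrite /good_round implybE.
apply: measurable_or.
  apply: measurable_neg; apply: measurable_fun_eqn => //.
  exact: measurableT_comp measurable_snd (measurableT_comp measurable_fst mround).
apply: measurable_fun_eqr => //.
exact: measurableT_comp measurable_snd mround.
Qed.

End Construction.

Theorem theorem5p1 (R : realType) (k d T n : nat) (prior_arm : nat -> 'I_k)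
    (delta eta : R) (S : payment_scheme R k) :
  (3 <= k)%N -> (0 < d)%N ->
  (forall j : 'I_k, (d <= #|[pred s : 'I_n | prior_arm s == j]|)%N) ->
  0 < delta < 1 -> 0 < eta < 1 ->
  exists I : instance R d n prior_arm,
    holds_with_prob S I (1 - delta)
      (fun (w : prior_rewards R n) (h : T.-tuple (agent_round R k)) =>
        forall t : 'I_T,
          ~ fair_round S I w (history_before h t) \/
          ((k.-1%:R / k%:R * (1 - eta))%:E
             <= expected_cost S I w (history_before h t))%E).
Proof.
move=> k3 d0 enough_prior /andP[delta0 delta1] /andP[eta0 eta1].
have j0 : 'I_k := Ordinal (leq_trans (isT : 0 < 3)%N k3).
have i0 : 'I_d := Ordinal d0.
(* With this choice [n%:R * e] equals [delta - e], so the failure probability stays below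
   [delta]. *)
pose e : R := delta / n.+1%:R.
have n1_gt0 : 0 < n.+1%:R :> R by rewrite ltr0n.
have e0 : 0 < e by rewrite divr_gt0.
have ne_le : n%:R * e + e = delta.
  by rewrite -{2}[e]mul1r -mulrDl natr1 mulrC divfK// gt_eqF.
have ne0 : 0 <= n%:R * e by rewrite mulr_ge0// ltW.
have e01 : 0 < e <= 1 by rewrite e0 /=; lra.
exists (hard_instance prior_arm j0 i0 e e01 enough_prior).
exists [set wh |
  [forall s : 'I_n, good_prior_reward prior_arm j0 i0 e s (tnth wh.1 s)] &&
  [forall s : 'I_T, good_round j0 (tnth wh.2 s)]]; split.
- exact: measurable_good_event.
- move=> w h /= /andP[/forallP good_w /forallP good_h] t.
  have [fair|] := pselect (fair_round S
    (hard_instance prior_arm j0 i0 e e01 enough_prior) w (history_before h t));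
    [right|by left].
  apply: le_trans (hard_round _ _ _ _ _ _ w (history_before h t) good_w _ S fair).
    (* Good histories give the bound [k.-1%:R / k%:R]; the factor [1 - eta] only lowers it. *)
    rewrite lee_fin ler_piMr ?divr_ge0//; lra.
  (* A prefix of a good history is good. *)
  by move=> s; rewrite tnth_mktuple.
- apply: le_trans (hard_probability _ _ _ _ _ _ S T).
  rewrite lee_fin; lra.
Qed.
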